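(* Let $X=Y=\mathbb R^d$ and $\Omega=\mathbb R^d\times\mathbb R^d$. Then $\mathfrak D$ and $\mathfrak D+(\mathcal C_\ell'')_-$ are regularly convex subsets of $\mathcal C_\ell''$. In particular, $$\mathfrak D=\mathfrak M\qquad\text{and}\qquad \mathfrak D+(\mathcal C_\ell'')_-=\mathfrak S .$$ Hence any martingale (element of $\mathfrak M$) has the form $T''(\mathfrak g)$ for some $\mathfrak g\in C_b''(X;\mathbb R^d)$, and $\mathfrak h\in\mathcal C_\ell''$ is a super-martingale (element of $\mathfrak S$) if and only if it is dominated by a martingale, i.e. $\mathfrak h\le\mathfrak m$ for some $\mathfrak m\in\mathfrak M$.
   Context: Let $\ell(x,y)=(1+|x|)+(1+|y|)$ and let $\mathcal C_\ell$ be the Banach lattice of continuous $f:\Omega\to\mathbb R$ with $\|f\|_\ell=\sup_\Omega|f|/\ell<\infty$. Primes denote topological duals, ordered by duality; $(\cdot)_\pm$ denotes positive/negative elements. $C_b(X;\mathbb R^d)$ is the space of bounded continuous $\mathbb R^d$-valued functions with the supremum norm, and $C_b''(X;\mathbb R^d)$ its bidual. $T:C_b(X;\mathbb R^d)\to\mathcal C_\ell$ is the bounded linear map $T(\gamma)(x,y)=\gamma(x)\cdot(x-y)$; $T'$ is its adjoint and $T'':C_b''(X;\mathbb R^d)\to\mathcal C_\ell''$ is the adjoint of $T'$. $\mathfrak D=\{T''(\mathfrak g):\mathfrak g\in C_b''(X;\mathbb R^d)\}$. $\mathcal M=\{\eta\in\mathcal C_\ell':\eta(T(\gamma))=0\ \forall\gamma\in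 C_b(X;\mathbb R^d)\}$. $\mathfrak M=\mathcal M^\perp=\{\mathfrak m\in\mathcal C_\ell'':\mathfrak m(\eta)=0\ \forall\eta\in\mathcal M\}$; its elements are called martingales. $\mathfrak S=\{\mathfrak h\in\mathcal C_\ell'':\mathfrak h(\eta)\le0\ \forall\eta\in\mathcal M\cap(\mathcal C_\ell')_+\}$; its elements are called super-martingales. A subset $\mathfrak A$ of the dual $\mathcal Z'$ of a Banach space $\mathcal Z$ is regularly convex if for every $\mathfrak b\in\mathcal Z'\setminus\mathfrak A$ there is $\eta\in\mathcal Z$ with $\sup_{\mathfrak f\in\mathfrak A}\mathfrak f(\eta)<\mathfrak b(\eta)$ (equivalently, $\mathfrak A$ is convex and weak$^*$ closed). Here $\mathcal Z=\mathcal C_\ell'$. *)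

(* Defs.v *)
From HB Require Import structures.
From mathcomp Require Import all_boot all_order all_algebra.
From mathcomp Require Import all_classical all_reals all_analysis.
From mathcomp Require Import lra.

Set Implicit Arguments.
Unset Strict Implicit.
Unset Printing Implicit Defensive.

Import Order.TTheory GRing.Theory Num.Theory.
Import numFieldNormedType.Exports.

Local Open Scope classical_set_scope.
Local Open Scope ring_scope.

(* The library equips 'rV[R]_d with the max norm; [euclid R d] is the same
   vector space with the Euclidean norm. *)
Section euclid.
Variables (R : realType) (d : nat).

Definition euclid : Type := 'rV[R]_d.

HB.instance Definition _ := GRing.Lmodule.copy euclid 'rV[R]_d.

Definition dotp (u v : euclid) : R := \sum_(i < d) u 0 i * v 0 i.

Lemma dotpC u v : dotp u v = dotp v u.
Proof. by apply: eq_bigr => i _; rewrite mulrC. Qed.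

Lemma dotpDl u1 u2 v : dotp (u1 + u2) v = dotp u1 v + dotp u2 v.
Proof. by rewrite -big_split; apply: eq_bigr => i _; rewrite mxE mulrDl. Qed.

Lemma dotpZl a u v : dotp (a *: u) v = a * dotp u v.
Proof. by rewrite mulr_sumr; apply: eq_bigr => i _; rewrite mxE mulrA. Qed.

Lemma dotpDr u v1 v2 : dotp u (v1 + v2) = dotp u v1 + dotp u v2.
Proof. by rewrite dotpC dotpDl !(dotpC u). Qed.

Lemma dotpZr a u v : dotp u (a *: v) = a * dotp u v.
Proof. by rewrite dotpC dotpZl dotpC. Qed.

Lemma dotp_ge0 u : 0 <= dotp u u.
Proof. by apply: sumr_ge0 => i _; rewrite -expr2 sqr_ge0. Qed.

Lemma dotp_eq0 u : dotp u u = 0 -> u = 0.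
Proof.
move=> /eqP; rewrite psumr_eq0; last by move=> i _; rewrite -expr2 sqr_ge0.
move=> /allP u0; apply/rowP => i; rewrite mxE; apply/eqP.
by have := u0 i (mem_index_enum _); rewrite /= -expr2 sqrf_eq0.
Qed.

Lemma dotp_sqr_le u v : dotp u v ^+ 2 <= dotp u u * dotp v v.
Proof.
have [v0|v0] := eqVneq (dotp v v) 0.
  have -> : v = 0 *: v by rewrite scale0r; exact: dotp_eq0.
  by rewrite !dotpZr !mul0r mulr0 expr0n.
have vgt0 : 0 < dotp v v by rewrite lt_def v0 dotp_ge0.
have := dotp_ge0 (dotp v v *: u + (- dotp u v) *: v).
rewrite !(dotpDl, dotpDr, dotpZl, dotpZr) (dotpC v u) => h.
by rewrite -subr_ge0 -(pmulr_rge0 _ vgt0); apply: le_trans h _; lra.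
Qed.

Definition enorm (u : euclid) : R := Num.sqrt (dotp u u).

Lemma dotp_le u v : `|dotp u v| <= enorm u * enorm v.
Proof.
rewrite -sqrtrM ?dotp_ge0// -sqrtr_sqr ler_sqrt ?dotp_sqr_le//.
by rewrite mulr_ge0 ?dotp_ge0.
Qed.

Let enorm_sqr u : enorm u ^+ 2 = dotp u u.
Proof. by rewrite sqr_sqrtr ?dotp_ge0. Qed.

Let enormD u v : enorm (u + v) <= enorm u + enorm v.
Proof.
rewrite -(@ler_pXn2r _ 2)// ?nnegrE ?addr_ge0 ?sqrtr_ge0//.
rewrite sqrrD !enorm_sqr !(dotpDl, dotpDr) (dotpC v u).
have := le_trans (ler_norm _) (dotp_le u v).
lra.
Qed.

Let enormZ a u : enorm (a *: u) = `|a| * enorm u.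
Proof.
by rewrite /enorm dotpZl dotpZr mulrA -expr2 sqrtrM ?sqr_ge0// sqrtr_sqr.
Qed.

Let enorm_eq0 u : enorm u = 0 -> u = 0.
Proof. by move=> u0; apply: dotp_eq0; rewrite -enorm_sqr u0 expr0n. Qed.

HB.instance Definition _ :=
  Lmodule_isNormed.Build R euclid enormD enormZ enorm_eq0.

Lemma normr_dotp_le (u v : euclid) : `|dotp u v| <= `|u| * `|v|.
Proof. exact: dotp_le. Qed.

End euclid.

(* Continuous linear maps between normed spaces, with the operator norm. *)
Section clinear.
Variables (R : realType) (V W : normedModType R).

Definition clinear_pred : {pred V -> W} :=
  [pred f | `[< linear f /\ continuous f >]].

Record clinear := CLinear {
  clinear_fun :> V -> W;
  clinear_funP : clinear_fun \in clinear_pred }.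

HB.instance Definition _ := [isSub for clinear_fun].
HB.instance Definition _ := [Choice of clinear by <:].

Let clinear_closed : submod_closed clinear_pred.
Proof.
split.
  apply/asboolP; split; first by move=> a u v; rewrite [RHS](_ : _ = a *: 0 + 0 :> W)// scaler0 addr0.
  by move=> x; exact: cvg_cst.
move=> a f g /asboolP[fl fc] /asboolP[gl gc]; apply/asboolP; split.
  move=> b u v; rewrite !fctE fl gl !scalerDr !scalerA (mulrC a) !addrA.
  by congr (_ + _); rewrite -!addrA; congr (_ + _); rewrite addrC.
by move=> x; apply: cvgD; [apply: cvgZr; exact: fc | exact: gc].
Qed.

HB.instance Definition _ :=
  GRing.isSubmodClosed.Build R (V -> W) clinear_pred clinear_closed.
HB.instance Definition _ := [SubChoice_isSubLmodule of clinear by <:].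

Let clinear_linear (f : clinear) : linear f.
Proof. by have /asboolP[] := clinear_funP f. Qed.

HB.instance Definition _ (f : clinear) :=
  GRing.isLinear.Build R V W _ f (clinear_linear f).

Lemma clinear_continuous (f : clinear) : continuous f.
Proof. by have /asboolP[] := clinear_funP f. Qed.

Definition opnorm (f : clinear) : R :=
  sup [set `|f x| | x in [set x | `|x| <= 1]].

Lemma opnorm_has_sup (f : clinear) :
  has_sup [set `|f x| | x in [set x | `|x| <= 1]].
Proof.
split; first by exists `|f 0|; exists 0 => //=; rewrite normr0 ler01.
have /linear_bounded_continuous/linear_boundedP := @clinear_continuous f.
move=> /pinfty_ex_gt0[r r0 fr]; exists r => _ [x /= x1 <-].
by apply: le_trans (fr x) _; rewrite ler_piMr// ltW.
Qed.

Lemma opnorm_le (f : clinear) x : `|f x| <= opnorm f * `|x|.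
Proof.
have [->|x0] := eqVneq x 0; first by rewrite linear0 !normr0 mulr0.
have x0' : 0 < `|x| by rewrite normr_gt0.
rewrite -ler_pdivrMr//; apply: ub_le_sup; first by case: (opnorm_has_sup f).
exists (`|x|^-1 *: x) => /=; first by rewrite normfZV.
by rewrite linearZ normrZ normfV normr_id mulrC.
Qed.

Lemma opnorm_ub (f : clinear) M :
  (forall x, `|x| <= 1 -> `|f x| <= M) -> opnorm f <= M.
Proof.
move=> fM; apply: ge_sup; first by case: (opnorm_has_sup f).
by move=> _ [x /= x1 <-]; exact: fM.
Qed.

Let opnorm_ge0 f : 0 <= opnorm f.
Proof.
apply: ub_le_sup; first by case: (opnorm_has_sup f).
by exists 0; rewrite /= ?linear0 normr0.
Qed.

Let opnormD f g : opnorm (f + g) <= opnorm f + opnorm g.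
Proof.
apply: opnorm_ub => x x1; apply: le_trans (ler_normD _ _) _.
apply: lerD; apply: le_trans (opnorm_le _ _) _;
  by rewrite ler_piMr ?opnorm_ge0.
Qed.

Let opnormZ_le a f : opnorm (a *: f) <= `|a| * opnorm f.
Proof.
apply: opnorm_ub => x x1; rewrite [X in `|X|](_ : _ = a *: f x)// normrZ.
rewrite ler_wpM2l//; apply: le_trans (opnorm_le _ _) _.
by rewrite ler_piMr ?opnorm_ge0.
Qed.

Let opnormZ a f : opnorm (a *: f) = `|a| * opnorm f.
Proof.
apply/eqP; rewrite eq_le opnormZ_le/=.
have [->|a0] := eqVneq a 0; first by rewrite normr0 mul0r opnorm_ge0.
rewrite -ler_pdivlMl ?normr_gt0//.
by have := opnormZ_le a^-1 (a *: f); rewrite scalerA mulVf// scale1r normfV.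
Qed.

Let opnorm_eq0 f : opnorm f = 0 -> f = 0.
Proof.
move=> f0; apply: val_inj; apply/funext => x; apply/eqP; rewrite -normr_le0.
by have := opnorm_le f x; rewrite f0 mul0r.
Qed.

HB.instance Definition _ :=
  Lmodule_isNormed.Build R clinear opnormD opnormZ opnorm_eq0.

End clinear.

Arguments clinear_pred {R} V W _.

Notation dual V := (@clinear _ V (GRing.regular _)).

Section adjoint.
Variables (R : realType) (V W : normedModType R) (L : clinear V W).

Let adjoint_funP (eta : dual W) : (eta \o L : V -> R^o) \in clinear_pred V R^o.
Proof.
apply/asboolP; split; first by move=> a u v; rewrite /= !linearP.
by move=> x; apply: continuous_comp; exact: clinear_continuous.
Qed.

Definition adjoint_fun (eta : dual W) : dual V := CLinear (adjoint_funP eta).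

Let adjointP : adjoint_fun \in clinear_pred (dual W) (dual V).
Proof.
have lin : linear adjoint_fun by move=> a u v; apply: val_inj; apply/funext.
apply/asboolP; split=> //.
pose H := GRing.isLinear.Build R _ _ _ adjoint_fun lin.
pose f : {linear dual W -> dual V} := HB.pack adjoint_fun H.
apply: (@bounded_linear_continuous _ _ _ f); apply/linear_boundedP.
near=> r => eta; apply: (@le_trans _ _ (`|L| * `|eta|)); last first.
  by rewrite ler_wpM2r//; near: r; apply: nbhs_pinfty_ge; rewrite num_real.
apply: opnorm_ub => x x1; apply: le_trans (opnorm_le eta (L x)) _.
rewrite mulrC ler_wpM2r//; first exact: (normr_ge0 eta).
apply: le_trans (opnorm_le L x) _; rewrite ler_piMr//; exact: (normr_ge0 L).
Unshelve. all: by end_near. Qed.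

Definition adjoint : clinear (dual W) (dual V) := CLinear adjointP.

End adjoint.

(* Continuous functions f : S -> W for which the supremum of |f| / w is finite,
   normed by this supremum. *)
Section wcont.
Variables (R : realType) (S : topologicalType) (w : S -> {posnum R}).
Variable W : normedModType R.

Definition wcont_pred : {pred S -> W} :=
  [pred f | `[< continuous f /\
                has_ubound (range (fun x => `|f x| / (w x)%:num)) >]].

Record wcont := WCont {
  wcont_fun :> S -> W;
  wcont_funP : wcont_fun \in wcont_pred }.

HB.instance Definition _ := [isSub for wcont_fun].
HB.instance Definition _ := [Choice of wcont by <:].

Let wcont_closed : submod_closed wcont_pred.
Proof.
split.
  apply/asboolP; split; first by move=> x; exact: cvg_cst.
  by exists 0 => _ [x _ <-]; rewrite normr0 mul0r.
move=> a f g /asboolP[fc [M fM]] /asboolP[gc [N gN]]; apply/asboolP; split.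
  by move=> x; apply: cvgD; [apply: cvgZr; exact: fc | exact: gc].
exists (`|a| * M + N) => _ [x _ <-].
apply: (@le_trans _ _ (`|a| * (`|f x| / (w x)%:num) + `|g x| / (w x)%:num)).
  by rewrite mulrA -mulrDl ler_pM2r// -normrZ; exact: ler_normD.
apply: lerD; last by apply: gN; exists x.
by apply: ler_wpM2l => //; apply: fM; exists x.
Qed.

HB.instance Definition _ :=
  GRing.isSubmodClosed.Build R (S -> W) wcont_pred wcont_closed.
HB.instance Definition _ := [SubChoice_isSubLmodule of wcont by <:].

Lemma wcont_continuous (f : wcont) : continuous f.
Proof. by have /asboolP[] := wcont_funP f. Qed.

Definition wnorm (f : wcont) : R := sup (range (fun x => `|f x| / (w x)%:num)).

Lemma wnorm_le (f : wcont) x : `|f x| <= wnorm f * (w x)%:num.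
Proof.
rewrite -ler_pdivrMr//; apply: ub_le_sup; last by exists x.
by have /asboolP[] := wcont_funP f.
Qed.

Lemma wnorm_ge0 (f : wcont) : 0 <= wnorm f.
Proof.
rewrite /wnorm; set A := (X in sup X).
have [->|/set0P[_ [x _ _]]] := eqVneq A set0.
  by rewrite sup0.
by have := le_trans (normr_ge0 _) (wnorm_le f x); rewrite pmulr_lge0.
Qed.

Lemma wnorm_ub (f : wcont) M : 0 <= M ->
  (forall x, `|f x| <= M * (w x)%:num) -> wnorm f <= M.
Proof.
move=> M0 fM; rewrite /wnorm; set A := (X in sup X).
have [->|/set0P[y fy]] := eqVneq A set0.
  by rewrite sup0.
apply: ge_sup; first by exists y; exact: fy.
by move=> _ [x _ <-]; rewrite ler_pdivrMr.
Qed.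

Let wnormD f g : wnorm (f + g) <= wnorm f + wnorm g.
Proof.
apply: wnorm_ub => [|x]; first by rewrite addr_ge0 ?wnorm_ge0.
by apply: le_trans (ler_normD _ _) _; rewrite mulrDl lerD ?wnorm_le.
Qed.

Let wnormZ_le a f : wnorm (a *: f) <= `|a| * wnorm f.
Proof.
apply: wnorm_ub => [|x]; first by rewrite mulr_ge0 ?wnorm_ge0.
rewrite [X in `|X|](_ : _ = a *: f x)// normrZ.
by rewrite -mulrA ler_wpM2l// wnorm_le.
Qed.

Let wnormZ a f : wnorm (a *: f) = `|a| * wnorm f.
Proof.
apply/eqP; rewrite eq_le wnormZ_le/=.
have [->|a0] := eqVneq a 0; first by rewrite normr0 mul0r wnorm_ge0.
rewrite -ler_pdivlMl ?normr_gt0//.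
by have := wnormZ_le a^-1 (a *: f); rewrite scalerA mulVf// scale1r normfV.
Qed.

Let wnorm_eq0 f : wnorm f = 0 -> f = 0.
Proof.
move=> f0; apply: val_inj; apply/funext => x; apply/eqP; rewrite -normr_le0.
by have := wnorm_le f x; rewrite f0 mul0r.
Qed.

HB.instance Definition _ :=
  Lmodule_isNormed.Build R wcont wnormD wnormZ wnorm_eq0.

End wcont.

Arguments wcont_pred {R S} w W _.

(* The supremum is taken in the extended reals, so that the inequality also
   says that the left-hand side is finite. *)
Definition regularly_convex (R : realType) (Z : normedModType R)
    (A : set (dual Z)) : Prop :=
  forall b : dual Z, ~ A b ->
    exists eta : Z, (ereal_sup [set (f eta)%:E | f in A] < (b eta)%:E)%E.

Definition dual_pos (R : realType) (V : normedModType R) (P : set V) :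
  set (dual V) := [set eta | forall f, P f -> 0 <= eta f].

Section martingales.
Variables (R : realType) (d : nat).
Local Notation E := (euclid R d).
Local Notation Omega := (E * E)%type.

Definition ell (p : Omega) : {posnum R} :=
  ((1 + `|p.1|) + (1 + `|p.2|))%:pos.

Definition Cl := wcont ell R^o.

Definition Cb := wcont (fun _ : E => 1%:pos) E.

Definition Cl_pos : set Cl := [set f | forall p, 0 <= f p].

Definition Cl'_pos : set (dual Cl) := dual_pos Cl_pos.

Definition Cl''_pos : set (dual (dual Cl)) := dual_pos Cl'_pos.

Definition Cl''_neg : set (dual (dual Cl)) := [set h | Cl''_pos (- h)].

Definition Cl''_le (h m : dual (dual Cl)) : Prop := Cl''_pos (m - h).

Lemma coord_continuous_euclid (i : 'I_d) :
  continuous (fun u : E => u 0 i : R^o).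
Proof.
have lin : linear (fun u : E => u 0 i : R^o) by move=> a u v; rewrite !mxE.
pose H := GRing.isLinear.Build R E R^o _ _ lin.
pose f : {linear E -> R^o} := HB.pack (fun u : E => u 0 i : R^o) H.
apply: (@bounded_linear_continuous _ _ _ f); apply/linear_boundedP.
near=> r => u; apply: (@le_trans _ _ (1 * `|u|)); last first.
  by rewrite ler_wpM2r//; near: r; apply: nbhs_pinfty_ge; rewrite num_real.
rewrite mul1r -sqrtr_sqr; apply: ler_wsqrtr.
rewrite /dotp (bigD1 i)//= -expr2 lerDl.
by apply: sumr_ge0 => j _; rewrite -expr2 sqr_ge0.
Unshelve. all: by end_near. Qed.

Lemma dotp_continuous (U : topologicalType) (f g : U -> E) :
  continuous f -> continuous g -> continuous (fun x => dotp (f x) (g x) : R^o).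
Proof.
move=> fc gc.
have fgc (h : U -> E) i : continuous h -> continuous (fun x : U => h x 0 i : R^o).
  move=> hc x; apply: (@continuous_comp _ _ _ h (fun u : E => u 0 i : R^o)).
    exact: hc.
  exact: coord_continuous_euclid.
have add_c : continuous (fun x : R^o * R^o => x.1 + x.2 : R^o).
  exact: add_continuous.
apply: (@continuous_big R^o 'I_d +%R 0 xpredT add_c U
  (index_enum 'I_d) (fun i x => f x 0 i * g x 0 i)) => i _ x.
by apply: cvgM; exact: fgc.
Qed.

Definition opT_val (g : Cb) (p : Omega) : R^o := dotp (g p.1) (p.1 - p.2).

Let opT_val_le g p : `|opT_val g p| <= `|g| * (ell p)%:num.
Proof.
apply: le_trans (normr_dotp_le _ _) _; apply: ler_pM => //.
  by have := wnorm_le g p.1; rewrite mulr1.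
by apply: le_trans (ler_normB _ _) _ => /=; lra.
Qed.

Let opT_valP g : opT_val g \in wcont_pred ell R^o.
Proof.
apply/asboolP; split.
  apply: dotp_continuous => x.
    by apply: continuous_comp; [exact: cvg_fst | exact: wcont_continuous].
  by apply: cvgB; [exact: cvg_fst | exact: cvg_snd].
by exists `|g| => _ [p _ <-]; rewrite ler_pdivrMr// opT_val_le.
Qed.

Definition opT_fun (g : Cb) : Cl := WCont (opT_valP g).

Let opT_funP : opT_fun \in clinear_pred Cb Cl.
Proof.
have lin : linear opT_fun.
  move=> a u v; apply: val_inj; apply/funext => p.
  by rewrite /= /opT_val dotpDl dotpZl.
apply/asboolP; split=> //.
pose H := GRing.isLinear.Build R _ _ _ opT_fun lin.
pose f : {linear Cb -> Cl} := HB.pack opT_fun H.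
apply: (@bounded_linear_continuous _ _ _ f); apply/linear_boundedP.
near=> r => g; apply: (@le_trans _ _ (1 * `|g|)); last first.
  by rewrite ler_wpM2r//; near: r; apply: nbhs_pinfty_ge; rewrite num_real.
by rewrite mul1r; apply: wnorm_ub => // p; exact: opT_val_le.
Unshelve. all: by end_near. Qed.

Definition opT : clinear Cb Cl := CLinear opT_funP.

Definition opT' : clinear (dual Cl) (dual Cb) := adjoint opT.

Definition opT'' : clinear (dual (dual Cb)) (dual (dual Cl)) := adjoint opT'.

Definition frakD : set (dual (dual Cl)) := range opT''.

Definition calM : set (dual Cl) := [set eta | forall g : Cb, eta (opT g) = 0].

Definition martingales : set (dual (dual Cl)) :=
  [set m | forall eta, calM eta -> m eta = 0].

Definition supermartingales : set (dual (dual Cl)) :=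
  [set h | forall eta, calM eta -> Cl'_pos eta -> h eta <= 0].

End martingales.

Arguments Cl_pos : clear implicits.
Arguments Cl'_pos : clear implicits.
Arguments Cl''_pos : clear implicits.
Arguments Cl''_neg : clear implicits.
Arguments frakD : clear implicits.
Arguments calM : clear implicits.
Arguments martingales : clear implicits.
Arguments supermartingales : clear implicits.

(* Main.v *)
From HB Require Import structures.
Require Import Defs.
From mathcomp Require Import all_boot all_order all_algebra.
From mathcomp Require Import all_classical all_reals all_analysis.
From mathcomp Require Import lra.

Set Implicit Arguments.
Unset Strict Implicit.
Unset Printing Implicit Defensive.

Import Order.TTheory GRing.Theory Num.Theory.
Import numFieldNormedType.Exports.
Local Open Scope classical_set_scope.
Local Open Scope ring_scope.

(** Everything rests on one estimate: if gamma is in Cb and k >= 0 in Cl, then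
    |gamma| <= |T gamma + k| ([opT_add_pos_ge]).  Fixing x and sending
    y = x - t gamma(x) to infinity, the quantity T gamma (x, y) =
    t |gamma(x)|^2 is positive and grows like |gamma(x)| ell(x, y), so adding a
    nonnegative function cannot bring the norm below |gamma|.

    By Hahn-Banach this is the same as saying that T' maps the positive cone of
    Cl' onto Cb' without loss of norm ([positive_preimage]).  Hence each eta in
    Cl' can be completed by some nu >= 0 with |nu| <= |T' eta| to an element
    eta + nu of the kernel calM of T' ([positive_completion]).

    For a super-martingale h and eta >= 0 this gives h(eta + nu) <= 0, that is
    h(eta) <= - h(nu) <= |h| |T' eta|.  A second use of Hahn-Banach, now on
    Cb', turns the bound into a g in Cb'' with h(eta) <= g(T' eta) for all
    eta >= 0: h is dominated by T'' g ([supermartingale_le_opT'']).  If h is a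
    martingale, testing the domination on the completion nu of eta reverses it,
    so h and T'' g agree on positive functionals, and then everywhere, every
    functional being the difference of an element of calM and a positive one.

    So D is the annihilator of calM and D + (Cl'')_- the polar of
    calM /\ (Cl')_+.  Sets cut out by such evaluations are regularly convex,
    the separating eta being one of those that define the set
    ([regularly_convex_polar]).

    Both uses of Hahn-Banach are instances of a theorem of Mazur-Orlicz type
    ([cone_functional]): on a convex cone K of pairs (v, r) with r <= C |v|, a
    single functional f of norm at most C satisfies r <= f v.  The first cone
    consists of the pairs (T gamma + k, phi gamma), which forces at once that
    f >= 0 and that f extends phi; the second of the pairs (T' eta, h eta). *)

(** * Sublinear functionals *)

Definition sublinear (R : realType) (V : lmodType R) (p : V -> R) : Prop :=
  (forall x y, p (x + y) <= p x + p y) /\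
  (forall a x, 0 < a -> p (a *: x) <= a * p x).

Definition convex_cone (R : realType) (V : lmodType R) (K : set V) : Prop :=
  [/\ K 0, (forall u v, K u -> K v -> K (u + v))
    & (forall a u, 0 < a -> K u -> K (a *: u))].

Lemma sublinear0 (R : realType) (V : lmodType R) (p : V -> R) :
  sublinear p -> p 0 = 0.
Proof.
move=> [_ pZ]; have := pZ 2 0 (ltr0Sn _ 1); have := pZ 2^-1 0.
rewrite !scaler0 => /(_ ltac:(by rewrite invr_gt0)); lra.
Qed.

Lemma sublinear_geN (R : realType) (V : lmodType R) (p : V -> R) x :
  sublinear p -> - p (- x) <= p x.
Proof.
move=> psub; have := psub.1 x (- x).
by rewrite subrr (sublinear0 psub); lra.
Qed.

(** The member [h] may depend on the points, so that the conditions cover both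
    chains of sublinear functionals, where [h] is the smaller of [f] and [g], and
    families indexed by a cone, where [h] has the sum of the two indices. *)
Lemma sublinear_inf (R : realType) (V : lmodType R) (F : set (V -> R))
    (b : V -> R) :
  F !=set0 -> (forall f x, F f -> b x <= f x) ->
  (forall f g x y, F f -> F g -> exists2 h, F h & h (x + y) <= f x + g y) ->
  (forall f a x, F f -> 0 < a -> exists2 h, F h & h (a *: x) <= a * f x) ->
  let q x := inf [set f x | f in F] in
  sublinear q /\ (forall f x, F f -> q x <= f x).
Proof.
move=> [f0 Ff0] Fb FD FZ q.
have q_le f x : F f -> q x <= f x.
  move=> Ff; apply: ge_inf; last by exists f.
  by exists (b x) => _ [g Fg <-]; exact: Fb.
have le_q x c : (forall f, F f -> c <= f x) -> c <= q x.
  move=> cf; apply: lb_le_inf; first by exists (f0 x); exists f0.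
  by move=> _ [f Ff <-]; exact: cf.
split=> //; split=> [x y|a x a0].
  rewrite -lerBlDr; apply: (le_q) => f Ff.
  rewrite lerBlDr -lerBlDl; apply: (le_q) => g Fg; rewrite lerBlDl.
  by have [h Fh] := FD _ _ x y Ff Fg; move=> ?; apply: le_trans (q_le _ _ Fh) _.
rewrite -ler_pdivrMl//; apply: (le_q) => f Ff; rewrite ler_pdivrMl//.
by have [h Fh] := FZ _ _ x Ff a0; move=> ?; apply: le_trans (q_le _ _ Fh) _.
Qed.

(** The functional is the infimum of [p (x + k.1) - k.2] over [k] in [K], which
    stays above [- p (- x)] because [k.2 <= p k.1].  A linear functional below
    it satisfies the lower bounds recorded by [K], which is how linear minorants
    are made to respect constraints. *)
Lemma sublinear_shift (R : realType) (V : lmodType R) (p : V -> R)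
    (K : set (V * R^o)) :
  sublinear p -> convex_cone K -> (forall k, K k -> k.2 <= p k.1) ->
  exists q, [/\ sublinear q, (forall x, q x <= p x)
    & (forall k, K k -> q (- k.1) <= - k.2)].
Proof.
move=> psub [K0 KD KZ] Kp; have [pD pZ] := psub.
pose F := [set (fun x => p (x + k.1) - k.2) | k in K].
have [||||qsub qF] := @sublinear_inf R V F (fun x => - p (- x)).
- by eexists; exists 0.
- move=> _ x [k Kk <-]; have := pD (x + k.1) (- x).
  by rewrite addrAC subrr add0r; have := Kp _ Kk; lra.
- move=> _ _ x y [k Kk <-] [l Kl <-].
  exists (fun z => p (z + (k + l).1) - (k + l).2).
    by exists (k + l) => //; exact: KD.
  by have := pD (x + k.1) (y + l.1); rewrite addrACA /=; lra.
- move=> _ a x [k Kk <-] a0.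
  exists (fun z => p (z + (a *: k).1) - (a *: k).2).
    by exists (a *: k) => //; exact: KZ.
  rewrite mulrBr -scalerDr; apply: lerB => //; exact: pZ.
exists (fun x => inf [set f x | f in F]); split=> // [x|k Kk].
  have := qF _ x (ex_intro2 _ _ 0 K0 erefl).
  by rewrite /= addr0 subr0.
have := qF _ (- k.1) (ex_intro2 _ _ k Kk erefl).
by rewrite /= addNr (sublinear0 psub) sub0r.
Qed.

(** Zorn's lemma applies since all sublinear functionals below [p] share the
    lower bound [- p (- x)], so that chains have pointwise infima. *)
Lemma sublinear_minimal (R : realType) (V : lmodType R) (p : V -> R) :
  sublinear p -> exists q, [/\ sublinear q, (forall x, q x <= p x)
    & (forall r, sublinear r -> (forall x, r x <= q x) -> r = q)].
Proof.
move=> psub.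
pose below (q : V -> R) := sublinear q /\ (forall x, q x <= p x).
pose T := {q : V -> R | below q}.
pose ge (q r : T) := `[< forall x, sval r x <= sval q x >].
have pP : below p by [].
have T_inj (q r : T) : sval q = sval r -> q = r.
  case: q r => [q qP] [r rP] /= qr; rewrite -{}qr in rP *.
  by rewrite (Prop_irrelevance qP rP).
have [||q r /asboolP qr /asboolP rq||q qmin] := @Zorn T ge.
- by move=> q; apply/asboolP.
- move=> q r s /asboolP qr /asboolP rs; apply/asboolP => x.
  exact: le_trans (rs x) (qr x).
- by apply: T_inj; apply/funext => x; apply/eqP; rewrite eq_le qr rq.
- move=> A Atot; have [->|/set0P[q0 Aq0]] := eqVneq A set0.
    by exists (exist below p pP).
  have [||||isub iA] := @sublinear_inf R V [set sval q | q in A]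
      (fun x => - p (- x)).
  + by exists (sval q0); exists q0.
  + move=> _ x [[q [qsub qp]] Aq <-] /=.
    by apply: le_trans (sublinear_geN x qsub); rewrite lerN2.
  (* Of two members of a chain, the smaller one witnesses subadditivity. *)
  + move=> _ _ x y [q Aq <-] [r Ar <-].
    have [/asboolP qr|/asboolP rq] := Atot _ _ Aq Ar.
      exists (sval r); first by exists r.
      by apply: le_trans ((svalP r).1.1 x y) _; exact: lerD.
    exists (sval q); first by exists q.
    by apply: le_trans ((svalP q).1.1 x y) _; exact: lerD.
  + move=> _ a x [q Aq <-] a0; exists (sval q); first by exists q.
    exact: (svalP q).1.2.
  set i := fun x : V => _ in isub iA.
  have iP : below i.
    split=> // x; apply: le_trans (iA _ x (ex_intro2 _ _ q0 Aq0 erefl)) _.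
    exact: (svalP q0).2.
  exists (exist below i iP) => q Aq; apply/asboolP => x /=.
  exact: (iA _ x (ex_intro2 _ _ q Aq erefl)).
exists (sval q); split; [exact: (svalP q).1|exact: (svalP q).2|].
move=> r rsub rq.
have rP : below r by split=> // x; exact: le_trans (rq x) ((svalP q).2 x).
by have /(congr1 sval) := qmin (exist below r rP) (introT (asboolP _) rq).
Qed.

Lemma sublinear_odd_linear (R : realType) (V : lmodType R) (q : V -> R^o) :
  sublinear q -> (forall x, q (- x) = - q x) -> linear q.
Proof.
move=> qsub qN; have [qD qZ] := qsub.
have addq x y : q (x + y) = q x + q y.
  apply/eqP; rewrite eq_le qD /=.
  by have := qD (- x) (- y); rewrite -opprD !qN; lra.
have pos a x : 0 < a -> q (a *: x) = a * q x.
  move=> a0; apply/eqP; rewrite eq_le qZ //=.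
  by have := qZ a (- x) a0; rewrite scalerN !qN mulrN lerN2.
move=> a x y; rewrite addq; congr (_ + _).
have [a0|a0|->] := ltgtP a 0; last by rewrite !scale0r (sublinear0 qsub).
  rewrite -[a]opprK scaleNr qN pos ?oppr_gt0//.
  by rewrite [in RHS]scaleNr.
by rewrite pos.
Qed.

(** A minimal sublinear functional [q] is odd: the pairs [(t *: y, t * q y)] with
    [t >= 0] form a cone below [q]; the corresponding shift of [q] is [q] itself
    by minimality, and it is at most [- q y] at [- y]. *)
Lemma sublinear_linear_minorant (R : realType) (V : lmodType R) (p : V -> R) :
  sublinear p ->
  exists f : V -> R^o, linear f /\ (forall x, f x <= p x).
Proof.
move=> /sublinear_minimal[q [qsub qp qmin]]; exists q; split=> //.
apply: sublinear_odd_linear => // y.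
pose ray : set (V * R^o) := [set (t *: y, t * q y) | t in [set t : R | 0 <= t]].
have rayc : convex_cone ray.
  split=> [|_ _ [s /= s0 <-] [t /= t0 <-]|a _ a0 [t /= t0 <-]].
  - by exists 0; rewrite /= ?scale0r ?mul0r.
  - by exists (s + t); rewrite /= ?addr_ge0// scalerDl mulrDl.
  - by exists (a * t); rewrite /= ?mulr_ge0 ?(ltW a0)// -scalerA -mulrA.
have ray_le k : ray k -> k.2 <= q k.1.
  move=> [t /= t0 <-] /=; have [->|t1] := eqVneq t 0.
    by rewrite mul0r scale0r (sublinear0 qsub).
  have tgt0 : 0 < t by rewrite lt_def t1.
  rewrite -ler_pdivlMl//.
  have := qsub.2 t^-1 (t *: y); rewrite invr_gt0 => /(_ tgt0).
  by rewrite scalerA mulVf// scale1r.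
have [r [rsub rq rray]] := sublinear_shift qsub rayc ray_le.
have rE := qmin _ rsub rq.
have yray : ray (y, q y) by exists 1; rewrite /= ?scale1r ?mul1r.
apply/eqP; rewrite eq_le; have := rray _ yray; rewrite rE /= => -> /=.
by have := sublinear_geN (- y) qsub; rewrite opprK.
Qed.

Lemma cone_linear_minorant (R : realType) (V : lmodType R) (p : V -> R)
    (K : set (V * R^o)) :
  sublinear p -> convex_cone K -> (forall k, K k -> k.2 <= p k.1) ->
  exists f : V -> R^o, [/\ linear f, (forall x, f x <= p x)
    & (forall k, K k -> k.2 <= f k.1)].
Proof.
move=> psub Kc Kp; have [q [qsub qp qK]] := sublinear_shift psub Kc Kp.
have [f [flin fq]] := sublinear_linear_minorant qsub.
exists f; split=> // [x|k Kk]; first exact: le_trans (fq x) (qp x).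
have f0 : f 0 = 0.
  by have := flin (-1) 0 0; rewrite scaler0 addr0 scaleN1r addNr.
have fN : f (- k.1) = - f k.1.
  by have := flin (-1) k.1 0; rewrite f0 !addr0 !scaleN1r.
by rewrite -lerN2 -fN; exact: le_trans (fq _) (qK _ Kk).
Qed.

(** An element of [K] is a constraint: the pair [(v, r)] demands [r <= f v].
    Taking arbitrary pairs, rather than the graph of a functional on a subspace,
    lets one statement cover both extension and domination. *)
Lemma cone_functional (R : realType) (V : normedModType R) (C : R)
    (K : set (V * R^o)) :
  0 <= C -> convex_cone K -> (forall k, K k -> k.2 <= C * `|k.1|) ->
  exists f : dual V, `|f| <= C /\ (forall k, K k -> k.2 <= f k.1).
Proof.
move=> C0 Kc KC.
have [|f [flin fC fK]] :=
  @cone_linear_minorant R V (fun x => C * `|x|) K _ Kc KC.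
  split=> [x y|a x a0]; first by rewrite -mulrDr ler_wpM2l// ler_normD.
  by rewrite normrZ gtr0_norm// mulrCA.
pose H := GRing.isLinear.Build R V R^o _ f flin.
pose F : {linear V -> R^o} := HB.pack f H.
have FC x : `|F x| <= C * `|x|.
  rewrite ler_norml fC andbT lerNl -[X in X <= _](linearN F).
  by rewrite -[`|x|]normrN; exact: fC.
have fP : f \in clinear_pred V R^o.
  apply/asboolP; split=> //.
  apply: (@bounded_linear_continuous _ _ _ F); apply/linear_boundedP.
  near=> r => x; apply: le_trans (FC x) _.
  by rewrite ler_wpM2r//; near: r; apply: nbhs_pinfty_ge; rewrite num_real.
exists (CLinear fP); split=> //.
apply: opnorm_ub => x x1; apply: le_trans (FC x) _.
by rewrite ler_piMr.
Unshelve. all: by end_near. Qed.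

(** * Positive functionals with prescribed restriction *)

Lemma opT_add_pos_ge (R : realType) (d : nat) (g : Cb R d) (k : Cl R d) :
  Cl_pos R d k -> `|g| <= `|opT R d g + k|.
Proof.
move=> k0; set f := opT R d g + k.
apply: wnorm_ub => // x; rewrite mulr1 leNgt; apply/negP.
set N := `|f|; set G := `|g x| => NG.
have N0 : 0 <= N by exact: normr_ge0.
have key t : 0 < t -> t * G ^+ 2 <= N * (2 + 2 * `|x| + t * G).
  move=> t0; pose y : euclid R d := x - t *: g x.
  (* In the direction opposite to g x the payoff g x . (x - y) is positive. *)
  have fy : t * G ^+ 2 <= f (x, y).
    have -> : f (x, y) = opT_val g (x, y) + k (x, y) by [].
    rewrite /opT_val /= (_ : x - y = t *: g x) ?dotpZr; last first.
      by rewrite /y opprB addrC subrK.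
    by rewrite [G ^+ 2]sqr_sqrtr ?dotp_ge0// lerDl; exact: k0.
  apply: le_trans fy _; apply: le_trans (ler_norm _) _.
  apply: le_trans (wnorm_le f (x, y)) _; apply: ler_wpM2l => //=.
  have := ler_normB x (t *: g x); rewrite normrZ (gtr0_norm t0) -/G -/y.
  lra.
have G0 : 0 < G by exact: le_lt_trans NG.
have NG0 : 0 < G * (G - N) by rewrite mulr_gt0// subr_gt0.
have A0 : 0 <= N * (2 + 2 * `|x|) by rewrite mulr_ge0// addr_ge0// mulr_ge0.
(* If N < G, then key bounds t * (G * (G - N)) by N * (2 + 2 * `|x|) for all
   t > 0; this t makes the product exceed the bound by one. *)
have := key ((N * (2 + 2 * `|x|) + 1) / (G * (G - N))).
rewrite divr_gt0// ?ltr_wpDl// => /(_ isT).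
set t := _ / _; have tE : t * (G * (G - N)) = N * (2 + 2 * `|x|) + 1.
  by rewrite mulfVK// gt_eqF.
lra.
Qed.

Lemma calM_kernel (R : realType) (d : nat) (eta : dual (Cl R d)) :
  calM R d eta <-> opT' R d eta = 0.
Proof.
split=> [M|T0 g]; first by apply: val_inj; apply/funext => g; exact: M.
by have -> : eta (opT R d g) = opT' R d eta g by []; rewrite T0.
Qed.

(** In the cone [K] below, the pairs with [g = 0] force positivity, and those
    with [f = 0], applied to [g] and [- g], force [eta (opT g) = phi g]; the bound
    needed on [K] is [opT_add_pos_ge] scaled by the norm of [phi]. *)
Lemma positive_preimage (R : realType) (d : nat) (phi : dual (Cb R d)) :
  exists eta : dual (Cl R d),
    [/\ Cl'_pos R d eta, `|eta| <= `|phi| & opT' R d eta = phi].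
Proof.
pose K : set (Cl R d * R^o) :=
  [set k | exists g, exists2 f, Cl_pos R d f & k = (opT R d g + f, phi g)].
have Kc : convex_cone K.
  split.
  - by exists 0, 0; rewrite ?linear0 ?addr0// => p; rewrite lexx.
  - move=> _ _ [g [f f0 ->]] [g' [f' f'0 ->]]; exists (g + g'), (f + f').
      by move=> p; exact: addr_ge0 (f0 p) (f'0 p).
    by rewrite !linearD/= addrACA.
  - move=> a _ a0 [g [f f0 ->]]; exists (a *: g), (a *: f).
      by move=> p; exact: mulr_ge0 (ltW a0) (f0 p).
    by rewrite !linearZ/= -scalerDr.
have [|k [g [f f0 ->]] /=|eta [etaC etaK]] :=
  @cone_functional R _ `|phi| K _ Kc.
- exact: normr_ge0.
- apply: le_trans (ler_norm _) _; apply: le_trans (opnorm_le phi g) _.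
  by rewrite ler_wpM2l//; [exact: (normr_ge0 phi)|exact: opT_add_pos_ge].
have etaT g : phi g <= eta (opT R d g).
  by apply: (etaK (opT R d g, phi g)); exists g, 0; rewrite ?addr0//.
exists eta; split=> //.
  move=> f f0; have /(_ _)/= := etaK (f, 0); apply.
  by exists 0, f; rewrite ?linear0 ?add0r.
apply: val_inj; apply/funext => g; apply/eqP; rewrite eq_le etaT andbT.
by have := etaT (- g); rewrite !linearN/= lerN2.
Qed.

Lemma positive_completion (R : realType) (d : nat) (eta : dual (Cl R d)) :
  exists nu : dual (Cl R d),
    [/\ Cl'_pos R d nu, `|nu| <= `|opT' R d eta| & calM R d (eta + nu)].
Proof.
have [nu [nu0 nu_le nuE]] := positive_preimage (- opT' R d eta).
exists nu; split=> //; first by rewrite -[`|opT' R d eta|]normrN.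
apply/calM_kernel.
have -> : opT' R d (eta + nu) = opT' R d eta + opT' R d nu by exact: linearD.
by rewrite nuE subrr.
Qed.

(** * Martingales and super-martingales *)

Lemma supermartingale_le_opT'' (R : realType) (d : nat)
    (h : dual (dual (Cl R d))) : supermartingales R d h ->
  exists g : dual (dual (Cb R d)),
    forall eta, Cl'_pos R d eta -> h eta <= opT'' R d g eta.
Proof.
move=> hS.
pose K : set (dual (Cb R d) * R^o) :=
  [set (opT' R d eta, h eta) | eta in Cl'_pos R d].
have posD eta eta' : Cl'_pos R d eta -> Cl'_pos R d eta' ->
    Cl'_pos R d (eta + eta').
  by move=> p p' f f0; exact: addr_ge0 (p f f0) (p' f f0).
have Kc : convex_cone K.
  split.
  - by exists 0; rewrite ?linear0// => f _; rewrite lexx.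
  - move=> _ _ [eta p <-] [eta' p' <-]; exists (eta + eta').
      exact: posD.
    by rewrite !linearD.
  - move=> a _ a0 [eta p <-]; exists (a *: eta).
      by move=> f f0; exact: mulr_ge0 (ltW a0) (p f f0).
    by rewrite !linearZ.
have [|_ [eta p <-] /=|g [_ gK]] := @cone_functional R _ `|h| K _ Kc.
- exact: normr_ge0.
- have [nu [nu0 nu_le M]] := positive_completion eta.
  have := hS _ M (posD _ _ p nu0); rewrite linearD/=.
  have : - h nu <= `|h| * `|opT' R d eta|.
    apply: le_trans (ler_norm _) _; rewrite normrN.
    apply: le_trans (opnorm_le h nu) _; rewrite ler_wpM2l//.
    exact: (normr_ge0 h).
  lra.
by exists g => eta p; apply: (gK (opT' R d eta, h eta)); exists eta.
Qed.

Lemma opT''_calM (R : realType) (d : nat) (g : dual (dual (Cb R d)))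
    (eta : dual (Cl R d)) : calM R d eta -> opT'' R d g eta = 0.
Proof.
move=> M; have -> : opT'' R d g eta = g (opT' R d eta) by [].
by rewrite (iffLR (calM_kernel eta) M) linear0.
Qed.

(** A martingale [m] is a super-martingale, so [m <= opT'' g] on positive
    functionals.  Both sides vanish on [eta + nu] in [calM], so the inequality at
    [nu >= 0] is the reverse one at [eta]. *)
Lemma martingales_frakD (R : realType) (d : nat) :
  martingales R d = frakD R d.
Proof.
apply/seteqP; split=> [m mM|_ [g _ <-] eta]; last exact: opT''_calM.
have [|g mg] := @supermartingale_le_opT'' R d m.
  by move=> eta M _; rewrite mM.
have mgE eta : Cl'_pos R d eta -> m eta = opT'' R d g eta.
  move=> eta0; apply/eqP; rewrite eq_le mg//=.
  have [nu [nu0 _ M]] := positive_completion eta.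
  have := mg _ nu0; have := mM _ M; have := opT''_calM g M.
  by rewrite !linearD/=; lra.
exists g => //; apply: val_inj; apply/funext => eta; apply: esym.
have [nu [nu0 _ M]] := positive_completion (- eta).
have := mM _ M; have := opT''_calM g M; have := mgE _ nu0.
rewrite 2!linearD 2!linearN; lra.
Qed.

Lemma supermartingalesP (R : realType) (d : nat) (h : dual (dual (Cl R d))) :
  supermartingales R d h <->
  exists2 m, martingales R d m & Cl''_le h m.
Proof.
split=> [/supermartingale_le_opT''[g hg]|[m mM hm] eta M eta0].
  exists (opT'' R d g); first by move=> eta; exact: opT''_calM.
  by move=> eta eta0; have := hg _ eta0; rewrite -subr_ge0.
have := hm _ eta0; have -> : (m - h) eta = m eta - h eta by [].
by rewrite mM// sub0r oppr_ge0.
Qed.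

(** * Regular convexity *)

Lemma regularly_convex_polar (R : realType) (Z : normedModType R)
    (P : set Z) (A : set (dual Z)) :
  (forall f, A f <-> forall eta, P eta -> f eta <= 0) ->
  regularly_convex A.
Proof.
move=> AP b nAb; apply: contrapT => nsep; apply: nAb; apply/AP => eta Peta.
rewrite leNgt; apply/negP => b0; apply: nsep; exists eta.
apply: (@le_lt_trans _ _ 0%E); last by rewrite lte_fin.
by apply: ub_ereal_sup => _ [f /AP Af <-]; rewrite lee_fin; exact: Af.
Qed.

Theorem proposition7p2 (R : realType) (d : nat) :
  let D := frakD R d in
  let Dneg := [set f + g | f in frakD R d & g in Cl''_neg R d] in
  [/\ regularly_convex D /\ regularly_convex Dneg,
      D = martingales R d,
      Dneg = supermartingales R d,
      (forall m : dual (dual (Cl R d)), martingales R d m ->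
         exists g : dual (dual (Cb R d)), m = opT'' R d g)
    & (forall h : dual (dual (Cl R d)), supermartingales R d h <->
         exists2 m, martingales R d m & Cl''_le h m)].
Proof.
move=> D Dneg.
have DE : D = martingales R d by rewrite martingales_frakD.
have DnegE : Dneg = supermartingales R d.
  apply/seteqP; split=> [_ [m Dm [n n0 <-]]|h /supermartingalesP[m mM hm]].
    apply/supermartingalesP; exists m; first by rewrite martingales_frakD.
    by rewrite /Cl''_le opprD addrA subrr sub0r.
  exists m; first by rewrite -martingales_frakD.
  by exists (h - m); [rewrite /Cl''_neg /= opprB|rewrite addrC subrK].
split=> //; last exact: supermartingalesP.
- rewrite DE DnegE; split.
    apply: (@regularly_convex_polar _ _ (calM R d)) => m.
    (* calM is closed under negation, so its polar is its annihilator. *)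
    split=> [mM eta /mM->//|m_le eta M]; apply/eqP; rewrite eq_le m_le//=.
    have /m_le : calM R d (- eta).
      move=> g; have -> : (- eta) (opT R d g) = - eta (opT R d g) by [].
      by rewrite M oppr0.
    by rewrite linearN oppr_le0.
  apply: (@regularly_convex_polar _ _
    (calM R d `&` Cl'_pos R d)) => h.
  by split=> [hS eta [M eta0]|hS eta M eta0]; exact: hS.
- by move=> m; rewrite martingales_frakD => -[g _ <-]; exists g.
Qed.
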